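(* Let $D\in[0,\infty]$ and $\mu\in[0,\infty)$, let $I$ be an index set, and let $x_i\in\mathbb{E}$, $g_i\in\mathbb{E}^*$, $f_i\in\mathbb{R}$ for $i\in I$. The set $\{(x_i,g_i,f_i)\}_{i\in I}$ is $\mathcal{S}_{D,\mu}$-interpolable (resp. $\mathcal{S}'_{D,\mu}$-interpolable) if and only if the following conditions hold for every pair of indices $i\in I$ and $j\in I$: $$f_i-f_j-\langle g_j,x_i-x_j\rangle\geq\frac{\mu}{2}\|x_i-x_j\|_{\mathbb{E}}^2,$$ $$\|x_j\|_{\mathbb{E}}\leq D\qquad(\text{resp. }\|x_j-x_i\|_{\mathbb{E}}\leq D).$$
   Context: $\mathbb{E}$ is a finite-dimensional real vector space with dual $\mathbb{E}^*$, $\langle\cdot,\cdot\rangle:\mathbb{E}^*\times\mathbb{E}\to\mathbb{R}$ is a dual pairing (nondegenerate bilinear map), $B:\mathbb{E}\to\mathbb{E}^*$ is a self-adjoint positive definite linear operator, and $\|x\|_{\mathbb{E}}^2=\langle Bx,x\rangle$ for $x\in\mathbb{E}$. $\mathcal{S}_{D,\mu}(\mathbb{E})$ ($D$-bounded $\mu$-strongly convex functions) is the set of proper, closed, convex functions $f:\mathbb{E}\to\mathbb{R}\cup\{\infty\}$ such that $f-\frac{\mu}{2}\|\cdot\|_{\mathbb{E}}^2$ is convex and $\|x\|_{\mathbb{E}}\leq D$ for all $x$ in the domain $\{x:f(x)<\infty\}$. $\mathcal{S}'_{D,\mu}(\mathbb{E})$ is defined in the same way, but with the last condition replaced by $\|x_1-x_2\|_{\mathbb{E}}\leq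 D$ for all $x_1,x_2$ in the domain. ($D=\infty$ means no boundedness requirement.) For a class $\mathcal{F}(\mathbb{E})$ of convex functions, a set $\{(x_i,g_i,f_i)\}_{i\in I}\subset\mathbb{E}\times\mathbb{E}^*\times\mathbb{R}$ is $\mathcal{F}$-interpolable if there exists $F\in\mathcal{F}(\mathbb{E})$ such that $g_i\in\partial F(x_i)$ and $F(x_i)=f_i$ for all $i\in I$, where $\partial F$ is the convex subdifferential (with respect to the pairing $\langle\cdot,\cdot\rangle$). *)

(* Defs.v *)
From HB Require Import structures.
From mathcomp Require Import all_boot all_order all_algebra.
From mathcomp Require Import all_classical all_reals all_analysis.

Set Implicit Arguments.
Unset Strict Implicit.
Unset Printing Implicit Defensive.

Import Order.TTheory GRing.Theory Num.Theory.
Import numFieldNormedType.Exports.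

Local Open Scope classical_set_scope.
Local Open Scope ring_scope.

Section ExtendedRealFunctions.
Variables (R : realType) (E : vectType R).
Implicit Type F : E -> \bar R.

(* The values of a proper function lie in the reals extended by +oo only. *)
Definition proper_fun F : Prop :=
  (exists x, (F x < +oo)%E) /\ (forall x, F x != -oo%E).

Definition dom_fun F : set E := [set x | (F x < +oo)%E].

(* MathComp-Analysis has 0 * +oo = 0, so the cases t = 0 and t = 1 are trivial. *)
Definition convex_fun F : Prop :=
  forall (x y : E) (t : R), 0 <= t -> t <= 1 ->
    (F (t *: x + (1 - t) *: y)%R <= t%:E * F x + (1 - t)%:E * F y)%E.

Definition epigraph F : set (E * R) := [set p | (F p.1 <= p.2%:E)%E].

(* A vectType carries no topology in the library: E gets the usual one of a
   finite-dimensional real space, pulled back from the row vectors by the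
   coordinate isomorphism. *)
Definition closed_fun F : Prop :=
  closed (epigraph F : set (initial_topology
    (VectorInternalTheory.v2r : E -> 'rV[R]_(dim E)) * R)%type).

End ExtendedRealFunctions.

Section EuclideanStructure.
Variables (R : realType) (E Es : vectType R).
Variable pairing : {bilinear Es -> E -> R | *%R & *%R}.
Variable B : {linear E -> Es}.

Definition nondegenerate_pairing : Prop :=
  (forall g, (forall x, pairing g x = 0) -> g = 0) /\
  (forall x, (forall g, pairing g x = 0) -> x = 0).

Definition self_adjoint : Prop := forall x y, pairing (B x) y = pairing (B y) x.

Definition positive_definite : Prop := forall x, x != 0 -> 0 < pairing (B x) x.

Definition normE (x : E) : R := Num.sqrt (pairing (B x) x).

Definition subdifferential (F : E -> \bar R) (x : E) : set Es :=
  [set g | forall y, (F x + (pairing g (y - x)%R)%:E <= F y)%E].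

Definition strongly_convex (mu : R) (F : E -> \bar R) : Prop :=
  convex_fun (fun x => F x - (mu / 2 * normE x ^+ 2)%:E)%E.

Definition class_S (D : \bar R) (mu : R) : set (E -> \bar R) :=
  [set F | [/\ proper_fun F, closed_fun F, convex_fun F, strongly_convex mu F &
    forall x, dom_fun F x -> ((normE x)%:E <= D)%E]].

Definition class_S' (D : \bar R) (mu : R) : set (E -> \bar R) :=
  [set F | [/\ proper_fun F, closed_fun F, convex_fun F, strongly_convex mu F &
    forall x1 x2, dom_fun F x1 -> dom_fun F x2 -> ((normE (x1 - x2))%:E <= D)%E]].

Definition interpolable (C : set (E -> \bar R)) (I : Type)
    (x : I -> E) (g : I -> Es) (f : I -> R) : Prop :=
  exists2 F, C F &
    forall i, subdifferential F (x i) (g i) /\ F (x i) = (f i)%:E.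

End EuclideanStructure.

(* Main.v *)
(* Necessity: divide the strong convexity inequality along the segment from
   [x j] to [x i] by its parameter t, after bounding F from below by the
   subgradient at [x j], and let t tend to 0. Sufficiency: take for F the
   supremum over j of the quadratics
     y |-> f j + <g j, y - x j> + mu/2 |y - x j|^2
   restricted to a closed convex set K containing the data and satisfying the
   bound. Subtracting mu/2 |y|^2 turns them into affine functions, so F is
   strongly convex; the interpolation inequalities say that the i-th quadratic
   is the largest one at [x i]. K is an intersection of balls of radius D: the
   ball centered at 0 for the first class, and for the second one the balls
   centered at all the points z with |z - x i| <= D for every i. An empty index
   set reduces to the single datum (0, 0, 0). *)
Require Import Defs.
From mathcomp Require Import all_boot all_order all_algebra.
From mathcomp Require Import all_classical all_reals all_analysis.
From mathcomp Require Import ring lra.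

Import Order.TTheory GRing.Theory Num.Theory.
Import numFieldNormedType.Exports.
Import VectorInternalTheory.

Set Implicit Arguments.
Unset Strict Implicit.
Unset Printing Implicit Defensive.

Local Open Scope classical_set_scope.
Local Open Scope ring_scope.

(** * Restricted suprema: convexity and closedness of extended-valued functions *)

Section ExtendedRealFunctions.
Variables (R : realType) (E : vectType R).

Definition convex_set (K : set E) : Prop :=
  forall x y t, 0 <= t -> t <= 1 -> K x -> K y -> K (t *: x + (1 - t) *: y).

Definition closed_set (K : set E) : Prop :=
  closed (K : set (initial_topology (v2r : E -> 'rV[R]_(dim E)))).

(** The value [+oo] off [K] encodes the restriction to [K]. For empty [J] the value on [K] is [-oo],
    so properness will require an index. *)
Definition sup_on (K : set E) (J : Type) (phi : J -> E -> R) (y : E) : \bar R :=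
  if `[< K y >] then ereal_sup (range (fun j => (phi j y)%:E)) else +oo%E.

Lemma sup_on_leP (K : set E) (J : Type) (phi : J -> E -> R) y r :
  (sup_on K phi y <= r%:E)%E <-> K y /\ forall j, phi j y <= r.
Proof.
rewrite /sup_on; case: asboolP => [Ky|nKy]; last first.
  by rewrite leye_eq; split => // -[].
split => [le_r|[_ le_r]].
  split=> // j; rewrite -lee_fin; apply: le_trans le_r.
  by apply: ereal_sup_ubound; exists j.
by apply: ge_ereal_sup => _ [j _ <-]; rewrite lee_fin.
Qed.

Lemma sup_on_ge (K : set E) (J : Type) (phi : J -> E -> R) y j :
  ((phi j y)%:E <= sup_on K phi y)%E.
Proof.
rewrite /sup_on; case: asboolP => _; last by rewrite leey.
by apply: ereal_sup_ubound; exists j.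
Qed.

Lemma dom_sup_on (K : set E) (J : Type) (phi : J -> E -> R) :
  dom_fun (sup_on K phi) `<=` K.
Proof. by move=> y; rewrite /dom_fun/= /sup_on; case: asboolP. Qed.

(** Only finite values matter: for [0 < t < 1] a value [+oo] at either end makes the right-hand side
    [+oo]. This avoids extended arithmetic later. *)
Lemma convex_fun_real_bounds (G : E -> \bar R) :
  (forall x, G x != -oo%E) ->
  (forall x y t a b, 0 <= t -> t <= 1 -> (G x <= a%:E)%E -> (G y <= b%:E)%E ->
     (G (t *: x + (1 - t) *: y)%R <= (t * a + (1 - t) * b)%R%:E)%E) ->
  convex_fun G.
Proof.
move=> GN le_G x y t t0 t1.
have [->|tN0] := eqVneq t 0.
  by rewrite scale0r add0r subr0 scale1r mul0e mul1e add0e.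
have [->|tN1] := eqVneq t 1.
  by rewrite subrr scale0r addr0 scale1r mul0e mul1e adde0.
have lt0t : 0 < t by rewrite lt_def tN0.
have lt0t' : 0 < 1 - t by rewrite subr_gt0 lt_def eq_sym tN1.
have := GN x; have := GN y.
case Gx : (G x) => [a| |] //; case Gy : (G y) => [b| |] // _ _.
- by rewrite -!EFinM -EFinD le_G// ?Gx ?Gy.
- by rewrite gt0_muley ?lte_fin// addey ?leey// -EFinM.
- by rewrite gt0_muley ?lte_fin// addye ?leey// -EFinM.
- by rewrite !gt0_muley ?lte_fin// leey.
Qed.

(** The epigraph is the cylinder over [K] intersected with the epigraphs of all [phi j], each closed
    by continuity. *)
Lemma closed_sup_on (K : set E) (J : Type) (phi : J -> E -> R) :
  closed_set K ->
  (forall j, continuous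
     (phi j : initial_topology (v2r : E -> 'rV[R]_(dim E)) -> R)) ->
  closed_fun (sup_on K phi).
Proof.
move=> clK cphi; rewrite /closed_fun.
pose T := initial_topology (v2r : E -> 'rV[R]_(dim E)).
have -> : epigraph (sup_on K phi) =
    (fst @^-1` K `&` \bigcap_(j in [set: J])
       (fun p : T * R => p.2 - phi j p.1) @^-1` [set r : R | 0 <= r])
    :> set (T * R).
  apply/seteqP; split => -[y r] /=.
    by move=> /sup_on_leP[Ky le_r]; split => // j _ /=; rewrite subr_ge0.
  move=> [Ky le_r]; apply/sup_on_leP; split=> // j.
  by have /= := le_r j I; rewrite subr_ge0.
apply: closedI.
  by apply: (@preimage_closed (T * R)%type T fst K) => // p _; exact: cvg_fst.
apply: closed_bigI => j _; apply: preimage_closed; last exact: closed_ge.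
move=> p _; apply: (@continuousB _ _ (T * R)%type snd (fun p => phi j p.1)).
  exact: cvg_snd.
by apply: (@continuous_comp (T * R)%type T R fst (phi j)); [exact: cvg_fst|exact: cphi].
Qed.

(** * Continuity in the coordinate topology *)

Lemma coordinate_continuous k : continuous
  ((fun y : E => v2r y ord0 k) :
    initial_topology (v2r : E -> 'rV[R]_(dim E)) -> R).
Proof.
move=> y; apply: (@continuous_comp (initial_topology (v2r : E -> _))
  'rV[R]_(dim E) R v2r (fun M => M ord0 k)).
  exact: initial_continuous.
exact: coord_continuous.
Qed.

Lemma linear_form_continuous (l : {linear E -> R | *%R}) :
  continuous (l : initial_topology (v2r : E -> 'rV[R]_(dim E)) -> R).
Proof.
pose T := initial_topology (v2r : E -> 'rV[R]_(dim E)).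
have -> : (l : T -> R) = fun y : T =>
    \sum_(k < dim E) (v2r (y : E)) ord0 k * l (r2v 'e_k).
  apply/funext => y.
  rewrite -[in LHS](v2rK y) {1}(row_sum_delta (v2r y)) !linear_sum.
  by apply: eq_bigr => k _; rewrite !linearZ.
apply: (@continuous_big _ _ _ _ _ _ T) => [|k _ y]; first exact: add_continuous.
apply: (@continuousM _ T (fun y => v2r (y : E) ord0 k) (cst (l (r2v 'e_k))));
  last exact: cst_continuous.
exact: coordinate_continuous.
Qed.

End ExtendedRealFunctions.

(** * The quadratic form of [B] and quadratic functions *)

Section EuclideanStructure.
Variables (R : realType) (E Es : vectType R).
Variables (pairing : {bilinear Es -> E -> R | *%R & *%R}) (B : {linear E -> Es}).
Hypotheses (saB : self_adjoint pairing B) (pdB : positive_definite pairing B).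

Local Notation q v := (pairing (B v) v).

Definition quad (c : R) (h : Es) (a : R) (y : E) : R := c * q y + pairing h y + a.

Lemma form_ge0 v : 0 <= q v.
Proof.
have [->|v0] := eqVneq v 0; first by rewrite linear0.
exact/ltW/pdB.
Qed.

Lemma sqr_normE v : normE pairing B v ^+ 2 = q v.
Proof. by rewrite sqr_sqrtr// form_ge0. Qed.

Lemma normE0 : normE pairing B 0 = 0.
Proof. by rewrite /normE linear0 sqrtr0. Qed.

Lemma normE_le v r : 0 <= r -> (normE pairing B v <= r) = (q v <= r ^+ 2).
Proof.
move=> r0; rewrite -sqr_normE ler_pXn2r// nnegrE; exact: sqrtr_ge0.
Qed.

Lemma normE_subC x y : normE pairing B (x - y) = normE pairing B (y - x).
Proof. by rewrite /normE -opprB !linearN/= linearNl opprK. Qed.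

Lemma formB x y : q (x - y) = q x - 2 * pairing (B y) x + q y.
Proof. rewrite !linearB/= !linearBl/= (saB x y). ring. Qed.

(** The affine part contributes no defect, and the form contributes exactly the last term. All
    convexity arguments below, and the expansion of [q] on a segment, come from this identity. *)
Lemma quad_convex_comb c h a x y t :
  quad c h a (t *: x + (1 - t) *: y) =
  t * quad c h a x + (1 - t) * quad c h a y - c * (t * (1 - t) * q (x - y)).
Proof.
rewrite /quad formB ![B (_ + _)]linearD ![B (_ *: _)]linearZ/=.
rewrite ![pairing _ (_ + _)]linearD/= ![pairing _ (_ *: _)]linearZ/=.
rewrite !linearDl !linearZl/= /GRing.scale/= (saB x y).
ring.
Qed.

Lemma quad_continuous c h a :
  continuous (quad c h a : initial_topology (v2r : E -> 'rV[R]_(dim E)) -> R).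
Proof.
pose T := initial_topology (v2r : E -> 'rV[R]_(dim E)).
have q_cont : continuous ((fun y : E => q y) : T -> R).
  (* Only the second argument is expanded in the basis; self-adjointness then moves [y] out of [B],
     leaving coordinates times linear forms. *)
  have -> : ((fun y : E => q y) : T -> R) = fun y : T =>
      \sum_(k < dim E) (v2r (y : E)) ord0 k * pairing (B (r2v 'e_k)) y.
    apply/funext => y.
    rewrite -[in X in pairing _ X](v2rK y) {1}(row_sum_delta (v2r y)) !linear_sum.
    by apply: eq_bigr => k _; rewrite !linearZ saB.
  apply: (@continuous_big _ _ _ _ _ _ T) => [|k _ y]; first exact: add_continuous.
  apply: (@continuousM _ T (fun y => v2r (y : E) ord0 k)
    (pairing (B (r2v 'e_k)))); last exact: linear_form_continuous.
  exact: coordinate_continuous.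
move=> y; apply: (@continuousD _ _ T (fun y => c * q y + pairing h y) (cst a)).
  apply: (@continuousD _ _ T (fun y => c * q y) (pairing h)).
    apply: (@continuousM _ T (cst c) (fun y => q y)); first exact: cst_continuous.
    exact: q_cont.
  exact: linear_form_continuous.
exact: cst_continuous.
Qed.

Lemma form_sub_quad z :
  (fun y => q (y - z)) = quad 1 (- (2 *: B z)) (q z).
Proof.
apply/funext => y; rewrite /quad formB linearNl linearZl/=; ring.
Qed.

(** * Intersections of balls *)

Definition balls (D : \bar R) (Z : set E) : set E :=
  [set y | forall z, Z z -> ((normE pairing B (y - z))%:E <= D)%E].

Lemma balls_convex D Z : (0 <= D)%E -> convex_set (balls D Z).
Proof.
case: D => [r||] // r0 x y t t0 t1 Kx Ky z Zz; last by rewrite leey.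
have := Kx z Zz; have := Ky z Zz; rewrite !lee_fin in r0 *.
rewrite !normE_le//.
rewrite -![q (_ - z)]/((fun v => q (v - z)) _) form_sub_quad quad_convex_comb.
move=> qy qx; rewrite mul1r lerBlDr.
rewrite -[leLHS]addr0 lerD//; last first.
  by rewrite mulr_ge0 ?form_ge0// mulr_ge0 ?subr_ge0.
rewrite (_ : r ^+ 2 = t * r ^+ 2 + (1 - t) * r ^+ 2); last by ring.
by rewrite lerD// ler_wpM2l// subr_ge0.
Qed.

Lemma balls_closed D Z : (0 <= D)%E -> closed_set (balls D Z).
Proof.
pose T := initial_topology (v2r : E -> 'rV[R]_(dim E)).
case: D => [r||] // r0; last first.
  have -> : balls +oo Z = setT by apply/seteqP; split=> // y _ z _; rewrite leey.
  exact: closedT.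
rewrite lee_fin in r0.
have -> : balls r%:E Z = \bigcap_(z in Z)
    (quad 1 (- (2 *: B z)) (q z) @^-1` [set s : R | s <= r ^+ 2]).
  apply/seteqP; split=> y Ky z Zz /=.
    by rewrite -form_sub_quad -normE_le// -lee_fin Ky.
  by rewrite lee_fin normE_le//; have /= := Ky z Zz; rewrite -form_sub_quad.
apply: (@closed_bigI T) => z _; apply: (@preimage_closed T R).
  by move=> y _; exact: quad_continuous.
exact: closed_le.
Qed.

(* The hull [K] replaces the closed convex hull of the data: it is an
   intersection of balls, and lies inside the set of its own centers. *)
Lemma diameter_hull (I : Type) (x : I -> E) (D : \bar R) :
  (forall i j, ((normE pairing B (x j - x i))%:E <= D)%E) ->
  let K := balls D (balls D (range x)) in
  (forall i, K (x i)) /\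
  forall y z, K y -> K z -> ((normE pairing B (y - z))%:E <= D)%E.
Proof.
move=> xD K; have xK i : K (x i).
  by move=> z /(_ (x i)); rewrite normE_subC; apply; exists i.
split=> // y z Ky Kz; apply: (Ky z) => _ [i _ <-]; apply: Kz => _ [j _ <-].
exact: xD.
Qed.

(** * The strong subgradient inequality and the interpolating function *)

Section Interpolation.
Variables (mu : R) (I : Type) (x : I -> E) (g : I -> Es) (f : I -> R).

Lemma strongly_convex_subgradient F y z gz a b :
  0 <= mu -> strongly_convex pairing B mu F -> subdifferential pairing F z gz ->
  F y = a%:E -> F z = b%:E ->
  mu / 2 * normE pairing B (y - z) ^+ 2 <= a - b - pairing gz (y - z).
Proof.
move=> mu0 scF sgz Fy Fz.
set p := pairing gz _; rewrite sqr_normE; set m := mu / 2 * _.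
have m0 : 0 <= m by rewrite mulr_ge0 ?form_ge0// divr_ge0.
(* The subgradient bounds [F] below by [b + t * p] at the intermediate point; strong convexity
   bounds it above with a gain of [t * (1 - t) * m]. Dividing by [t] leaves the claim. *)
have chord t : 0 < t -> t <= 1 -> (1 - t) * m <= a - b - p.
  move=> t0 t1.
  have := scF y z t (ltW t0) t1; have := sgz (t *: y + (1 - t) *: z).
  have -> : t *: y + (1 - t) *: z - z = t *: (y - z).
    by rewrite scalerBl scale1r scalerBr addrCA addrAC addrN add0r.
  rewrite Fy Fz linearZ/= -/p; case: (F _) => [r||] //.
  rewrite -!EFinB -!EFinM -!EFinD !lee_fin !sqr_normE => ler rle.
  have := quad_convex_comb 1 0 0 y z t; rewrite /quad !linear0l !mul1r !addr0.
  move=> eq; rewrite eq in rle; rewrite -(ler_pM2l t0) /m; nra.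
apply/ler_addgt0Pr => e e0.
have me0 : 0 < m + e by rewrite ltr_wpDl.
(* This parameter replaces the limit: it lies in [(0, 1]], even when [m = 0], and makes the lost
   term [t * m] at most [e]. *)
have := chord (e / (m + e)) (divr_gt0 e0 me0).
rewrite ler_pdivrMr// mul1r lerDr => /(_ m0).
have : e / (m + e) * m <= e.
  by rewrite mulrAC ler_pdivrMr// ler_pM2l// lerDl ltW.
lra.
Qed.

Lemma strongly_convex_interpolant (K : set E) (i0 : I) :
  0 <= mu -> closed_set K -> convex_set K -> (forall i, K (x i)) ->
  (forall i j, mu / 2 * normE pairing B (x i - x j) ^+ 2
     <= f i - f j - pairing (g j) (x i - x j)) ->
  exists F : E -> \bar R,
    [/\ proper_fun F, closed_fun F, convex_fun F, strongly_convex pairing B mu F &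
        dom_fun F `<=` K] /\
    forall i, subdifferential pairing F (x i) (g i) /\ F (x i) = (f i)%:E.
Proof.
move=> mu0 clK cvxK xK interp.
(* The quadratic centered at [x j], expanded so that its leading coefficient is visibly [mu / 2];
   [phiE] recovers the centered form. *)
pose phi j := quad (mu / 2) (g j - mu *: B (x j))
  (f j - pairing (g j) (x j) + mu / 2 * q (x j)).
have phiE j y : phi j y = f j + pairing (g j) (y - x j) + mu / 2 * q (y - x j).
  by rewrite /phi /quad formB !(linearB, linearBl, linearZl) /GRing.scale/=; field.
pose F := sup_on K phi; exists F.
have F_neqN y : F y != -oo%E.
  by rewrite -ltNye; apply: lt_le_trans (sup_on_ge K phi y i0); rewrite ltNyr.
have Fx i : F (x i) = (f i)%:E.
  apply/eqP; rewrite eq_le; apply/andP; split.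
    apply/sup_on_leP; split=> // j; rewrite phiE.
    by have := interp i j; rewrite sqr_normE; lra.
  apply: le_trans (sup_on_ge K phi (x i) i).
  by rewrite phiE subrr !linear0 mulr0 !addr0.
(* Taking [c = 0] gives convexity and [c = mu / 2] strong convexity; the remaining curvature
   [mu / 2 - c] is nonnegative. *)
have F_sub_convex c : c <= mu / 2 -> convex_fun (fun y => F y - (c * q y)%:E)%E.
  move=> cmu; apply: convex_fun_real_bounds => [y|y z t a b t0 t1].
    by have := F_neqN y; case: (F y).
  rewrite !leeBlDr// -!EFinD => /sup_on_leP[Ky ya] /sup_on_leP[Kz zb].
  apply/sup_on_leP; split=> [|j]; first exact: cvxK.
  have := quad_convex_comb 1 0 0 y z t; rewrite /quad !linear0l !mul1r !addr0 => ->.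
  rewrite /phi quad_convex_comb.
  have := ya j; have := zb j; rewrite /phi.
  have : 0 <= (mu / 2 - c) * (t * (1 - t) * q (y - z)).
    by rewrite mulr_ge0 ?subr_ge0// mulr_ge0 ?form_ge0// mulr_ge0 ?subr_ge0.
  nra.
split.
  split.
  - by split=> //; exists (x i0); rewrite Fx ltry.
  - by apply: closed_sup_on => // j; exact: quad_continuous.
  - have := F_sub_convex 0; rewrite divr_ge0// => /(_ isT).
    by under eq_fun do rewrite mul0r sube0.
  - rewrite /strongly_convex; under eq_fun do rewrite sqr_normE.
    exact: F_sub_convex.
  - exact: dom_sup_on.
move=> i; split=> // y; rewrite Fx -EFinD.
apply: le_trans (sup_on_ge K phi y i).
by rewrite phiE lee_fin lerDl mulr_ge0 ?form_ge0// divr_ge0.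
Qed.

End Interpolation.

End EuclideanStructure.

(** * The empty index set and the two equivalences *)

Lemma interpolable_empty (R : realType) (E Es : vectType R)
    (pairing : {bilinear Es -> E -> R | *%R & *%R}) (C : set (E -> \bar R))
    (I : Type) (x : I -> E) (g : I -> Es) (f : I -> R) :
  (I -> False) ->
  interpolable pairing C (fun _ : unit => 0) (fun _ => 0) (fun _ => 0) ->
  interpolable pairing C x g f.
Proof. by move=> I0 [F CF _]; exists F => // i; case: (I0 i). Qed.

Theorem theorem3p4 (R : realType) (E Es : vectType R)
    (pairing : {bilinear Es -> E -> R | *%R & *%R}) (B : {linear E -> Es})
    (D : \bar R) (mu : R) (I : Type)
    (x : I -> E) (g : I -> Es) (f : I -> R) :
  nondegenerate_pairing pairing -> self_adjoint pairing B -> positive_definite pairing B ->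
  (0 <= D)%E -> 0 <= mu ->
  (interpolable pairing (class_S pairing B D mu) x g f <->
    (forall i j : I,
       f i - f j - pairing (g j) (x i - x j)
         >= mu / 2 * normE pairing B (x i - x j) ^+ 2 /\
       ((normE pairing B (x j))%:E <= D)%E)) /\
  (interpolable pairing (class_S' pairing B D mu) x g f <->
    (forall i j : I,
       f i - f j - pairing (g j) (x i - x j)
         >= mu / 2 * normE pairing B (x i - x j) ^+ 2 /\
       ((normE pairing B (x j - x i))%:E <= D)%E)).
Proof.
move=> _ saB pdB D0 mu0.
have dom_interp F i : F (x i) = (f i)%:E -> dom_fun F (x i).
  by rewrite /dom_fun/= => ->; rewrite ltry.
(* One datum at the origin meets all conditions, so both classes are nonempty, which is all that an
   empty [I] requires. *)
have trivial_data (j k : unit) : mu / 2 * normE pairing B (0 - 0) ^+ 2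
    <= 0 - 0 - pairing 0 (0 - 0).
  by rewrite !subrr normE0 linear0l expr0n mulr0 subrr.
split; split.
- move=> [F [_ _ _ scF domF] interp] i j.
  have [_ Fi] := interp i; have [sgj Fj] := interp j.
  split; first exact: strongly_convex_subgradient Fi Fj.
  exact/domF/dom_interp.
(* The index type is left general so that the claim serves both [I] and [unit]. *)
- have nonempty_case (J : Type) (j0 : J) (y : J -> E) h a :
    (forall i j, mu / 2 * normE pairing B (y i - y j) ^+ 2
       <= a i - a j - pairing (h j) (y i - y j)) ->
    (forall j, ((normE pairing B (y j))%:E <= D)%E) ->
    interpolable pairing (class_S pairing B D mu) y h a.
    move=> interp yD.
    have y_ball j : balls pairing B D [set 0] (y j) by move=> _ ->; rewrite subr0.
    have [F [[pF clF cvxF scF domF] Fy]] := strongly_convex_interpolant saB pdB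
      j0 mu0 (balls_closed saB pdB D0) (balls_convex saB pdB D0) y_ball interp.
    exists F => //; split=> // z /domF /(_ 0 erefl); by rewrite subr0.
  move=> H; have [[i0]|I0] := pselect (inhabited I).
    by apply: nonempty_case => // [i j|j]; [case: (H i j)|case: (H j j)].
  apply: interpolable_empty; first by move=> i; apply: I0; exists.
  by apply: nonempty_case => // _; rewrite normE0.
- move=> [F [_ _ _ scF domF] interp] i j.
  have [_ Fi] := interp i; have [sgj Fj] := interp j.
  split; first exact: strongly_convex_subgradient Fi Fj.
  by apply: domF; exact: dom_interp.
- have nonempty_case (J : Type) (j0 : J) (y : J -> E) h a :
    (forall i j, mu / 2 * normE pairing B (y i - y j) ^+ 2
       <= a i - a j - pairing (h j) (y i - y j)) ->
    (forall i j, ((normE pairing B (y j - y i))%:E <= D)%E) ->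
    interpolable pairing (class_S' pairing B D mu) y h a.
    move=> interp yD; have [yK diamK] := diameter_hull yD.
    have [F [[pF clF cvxF scF domF] Fy]] := strongly_convex_interpolant saB pdB
      j0 mu0 (balls_closed saB pdB D0) (balls_convex saB pdB D0) yK interp.
    exists F => //; split=> // z1 z2 /domF z1K /domF; exact: diamK.
  move=> H; have [[i0]|I0] := pselect (inhabited I).
    by apply: nonempty_case => // i j; case: (H i j).
  apply: interpolable_empty; first by move=> i; apply: I0; exists.
  by apply: nonempty_case => // _ _; rewrite subrr normE0.
Qed.
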